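(* Let $(X,d)$ be a metric space and let $M$ be a closed nonempty proper subset of $X$. Let $F:(X\setminus M,d)\to(0,\infty)$ be a $1$-Lipschitz function. Then the metric defined by $$i(x,y)=2\log\frac{F(x)+F(y)+d(x,y)}{2\sqrt{F(x)F(y)}},\qquad x,y\in X\setminus M,$$ is Gromov hyperbolic with a Gromov constant $\delta\le\log 9$.
   Context: $\log$ is the natural logarithm. $F$ is $1$-Lipschitz if $|F(x)-F(y)|\le d(x,y)$ for all $x,y\in X\setminus M$. The function $i$ is a metric on $X\setminus M$. A metric $\rho$ on a set $S$ is Gromov hyperbolic with Gromov constant $\delta\ge 0$ if for all $x,y,z,w\in S$ $$\rho(x,z)+\rho(y,w)\le\max\{\rho(x,w)+\rho(y,z),\ \rho(x,y)+\rho(z,w)\}+2\delta .$$ *)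

(* Defs.v *)
(* MathComp-Analysis; the ambient metric space is a [metricType R] with
   distance [mdist], over an arbitrary [R : realType]. *)
From mathcomp Require Export all_boot all_order all_algebra.
From mathcomp Require Export all_classical all_reals all_analysis.

Set Implicit Arguments.
Unset Strict Implicit.
Unset Printing Implicit Defensive.

Import Order.TTheory GRing.Theory Num.Theory.
Import numFieldNormedType.Exports.

Local Open Scope classical_set_scope.
Local Open Scope ring_scope.

(* Unbundled counterpart of [metricType], for a distance that is not the
   canonical one of its carrier.  Nonnegativity follows from the axioms. *)
Record is_metric (R : realType) (S : Type) (rho : S -> S -> R) : Prop := {
  is_metric_eq0 : forall x y, rho x y = 0 <-> x = y ;
  is_metric_sym : forall x y, rho x y = rho y x ;
  is_metric_triangle : forall x y z, rho x z <= rho x y + rho y z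
}.

Definition gromov_hyperbolic (R : realType) (S : Type) (rho : S -> S -> R)
    (delta : R) : Prop :=
  [/\ is_metric rho,
      0 <= delta
    & forall x y z w : S,
        rho x z + rho y w <=
        Num.max (rho x w + rho y z) (rho x y + rho z w) + 2 * delta].

(* The library's [k.-lipschitz_A] requires a normed domain. *)
Definition one_lipschitz (R : realType) (S : Type) (rho : S -> S -> R)
    (F : S -> R) : Prop :=
  forall x y : S, `|F x - F y| <= rho x y.

(* A set [A : set X] used as a type is the subtype of its elements. *)
Definition subspace_dist (R : realType) (X : metricType R) (A : set X)
    (x y : A) : R :=
  mdist (\val x) (\val y).

Definition i_metric (R : realType) (X : metricType R) (A : set X)
    (F : A -> R) (x y : A) : R :=
  2 * ln ((F x + F y + subspace_dist x y) / (2 * Num.sqrt (F x * F y))).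

(* Main.v *)
Require Import Defs.
From mathcomp Require Import ring lra.

Set Implicit Arguments.
Unset Strict Implicit.
Unset Printing Implicit Defensive.

Import Order.TTheory GRing.Theory Num.Theory.
Import numFieldNormedType.Exports.

Local Open Scope classical_set_scope.
Local Open Scope ring_scope.

(** In terms of [s x y = F x + F y + d x y] one has
    [i x y = 2 * ln (s x y) - 2 * ln 2 - ln (F x) - ln (F y)].  In the
    four-point condition every pairing of [x], [y], [z], [w] contributes the
    same terms [ln (F _)] and [ln 2], so the condition with constant [ln 4]
    says that
    [s x z * s y w <= 4 * max (s x w * s y z, s x y * s z w)].
    This holds for every symmetric nonnegative function with the triangle
    inequality ([four_point_mul]), and [s] is such a function.

    The Lipschitz hypothesis is what makes [i] a metric: the triangle
    inequality for [i] amounts to [s x z * (2 * F y) <= s x y * s y z], and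
    with the triangle inequality of [d] the difference of the two sides is at
    least [(F x - F y + d x y) * (F z - F y + d y z)], whose two factors are
    nonnegative ([isum_submul]).  That [i x y] vanishes only on the diagonal
    is the arithmetic-geometric mean inequality.  Since [4 <= 9], the theorem
    follows. *)

(** Here [a] and [b] are the diagonals of a quadrilateral whose pairs of
    opposite sides are [p], [q] and [r], [t], with [r] a longest side.  The two
    hypotheses on [a] and [b] are the triangle inequalities that avoid [r], and
    [(p + t) * (t + q) = p * q + t * (p + t + q) <= p * q + 3 * (r * t)]. *)
Lemma mul_diagonals_le (R : realType) (a b p q r t : R) :
  0 <= a -> 0 <= b -> 0 <= p -> 0 <= q -> 0 <= t ->
  a <= p + t -> b <= t + q -> p <= r -> q <= r -> t <= r ->
  a * b <= 4 * Num.max (p * q) (r * t).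
Proof.
move=> a0 b0 p0 q0 t0 ha hb pr qr tr.
have ab : a * b <= (p + t) * (t + q) by exact: ler_pM.
have tp : t * p <= t * r by exact: ler_wpM2l.
have tq : t * q <= t * r by exact: ler_wpM2l.
have tt : t * t <= t * r by exact: ler_wpM2l.
have m1 : p * q <= Num.max (p * q) (r * t) by rewrite le_max lexx.
have m2 : r * t <= Num.max (p * q) (r * t) by rewrite le_max lexx orbT.
nra.
Qed.

Lemma four_point_mul (R : realType) (S : Type) (s : S -> S -> R) :
  (forall x y, 0 <= s x y) -> (forall x y, s x y = s y x) ->
  (forall x y z, s x z <= s x y + s y z) ->
  forall x y z w,
    s x z * s y w <= 4 * Num.max (s x w * s y z) (s x y * s z w).
Proof.
move=> s0 sC sT x y z w.
have xyz := sT x y z; have xwz := sT x w z.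
have yxw := sT y x w; have yzw := sT y z w.
rewrite (sC w z) in xwz; rewrite (sC y x) in yxw.
have diag := mul_diagonals_le (s0 x z) (s0 y w).
(* Find a longest side of the quadrilateral [x], [y], [z], [w]; the rewrites
   put it in the place of [r]. *)
have [xy_zw|/ltW zw_xy] := lerP (s x y) (s z w);
  have [xw_yz|/ltW yz_xw] := lerP (s x w) (s y z).
- have [zw_yz|/ltW yz_zw] := lerP (s z w) (s y z).
  + rewrite maxC (mulrC (s x y)) (mulrC (s x w)).
    by apply: diag => //; lra.
  + rewrite (mulrC (s x y)) (mulrC (s x w)).
    by apply: diag => //; lra.
- have [zw_xw|/ltW xw_zw] := lerP (s z w) (s x w).
  + rewrite maxC.
    by apply: diag => //; lra.
  + rewrite (mulrC (s x y)) (mulrC (s x w)).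
    by apply: diag => //; lra.
- have [xy_yz|/ltW yz_xy] := lerP (s x y) (s y z).
  + rewrite maxC (mulrC (s x y)) (mulrC (s x w)).
    by apply: diag => //; lra.
  + by apply: diag => //; lra.
- have [xy_xw|/ltW xw_xy] := lerP (s x y) (s x w).
  + rewrite maxC.
    by apply: diag => //; lra.
  + by apply: diag => //; lra.
Qed.

Lemma is_metric_ge0 (R : realType) (S : Type) (d : S -> S -> R) :
  is_metric d -> forall x y, 0 <= d x y.
Proof.
move=> [d0 dC dT] x y.
have dxx : d x x = 0 by apply/d0.
have := dT x y x; rewrite dxx (dC y x); lra.
Qed.

Lemma is_metric_subspace_dist (R : realType) (X : metricType R) (A : set X) :
  is_metric (@subspace_dist R X A).
Proof.
split=> [x y|x y|x y z]; rewrite /subspace_dist.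
- split=> [/mdist_positivity /val_inj //|->]; exact: mdistxx.
- exact: metric_sym.
- exact: metric_triangle.
Qed.

Section WeightedMetric.
Variables (R : realType) (S : Type) (d : S -> S -> R) (F : S -> R).
Hypothesis d_metric : is_metric d.
Hypothesis F_gt0 : forall x, 0 < F x.

Let dC := is_metric_sym d_metric.
Let dT := is_metric_triangle d_metric.
Let d_ge0 := is_metric_ge0 d_metric.

Definition isum (x y : S) : R := F x + F y + d x y.

(** [i_metric] over an arbitrary carrier. *)
Definition ilog (x y : S) : R :=
  2 * ln (isum x y / (2 * Num.sqrt (F x * F y))).

Lemma isum_gt0 x y : 0 < isum x y.
Proof.
have := F_gt0 x; have := F_gt0 y; have := d_ge0 x y; rewrite /isum; lra.
Qed.

Lemma isum_sym x y : isum x y = isum y x.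
Proof. by rewrite /isum dC (addrC (F x)). Qed.

Lemma isum_triangle x y z : isum x z <= isum x y + isum y z.
Proof. have := F_gt0 y; have := dT x y z; rewrite /isum; lra. Qed.

(** Given [d x z <= d x y + d y z], the right-hand side exceeds the left by at
    least [(F x - F y + d x y) * (F z - F y + d y z)], and the Lipschitz
    condition makes both factors nonnegative. *)
Lemma isum_submul : one_lipschitz d F ->
  forall x y z, isum x z * (2 * F y) <= isum x y * isum y z.
Proof.
move=> F_lip x y z.
have xy : 0 <= F x - F y + d x y.
  by have := F_lip x y; rewrite ler_norml => /andP[]; lra.
have yz : 0 <= F z - F y + d y z.
  by have := F_lip y z; rewrite ler_norml => /andP[]; lra.
have xyz : isum x z * (2 * F y) <= (F x + F z + (d x y + d y z)) * (2 * F y).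
  apply: ler_wpM2r; first by rewrite mulr_ge0// ltW.
  by rewrite /isum lerD2l dT.
apply: (le_trans xyz); rewrite -subr_ge0 /isum.
have := mulr_ge0 xy yz; congr (_ <= _); ring.
Qed.

Lemma ilogE x y :
  ilog x y = 2 * ln (isum x y) - 2 * ln 2 - ln (F x) - ln (F y).
Proof.
have FF : 0 < F x * F y by rewrite mulr_gt0.
have sqrtFF : 0 < Num.sqrt (F x * F y) by rewrite sqrtr_gt0.
have lnFF : 2 * ln (Num.sqrt (F x * F y)) = ln (F x) + ln (F y).
  by rewrite mulr_natl -lnXn// sqr_sqrtr ?ltW// lnM ?posrE.
rewrite /ilog ln_div ?posrE ?isum_gt0 ?mulr_gt0// lnM ?posrE//; lra.
Qed.

(** If [ilog x y = 0] then [isum x y] is twice the geometric mean of [F x] and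
    [F y], hence at most [F x + F y], which leaves [d x y <= 0]. *)
Lemma ilog_eq0 x y : ilog x y = 0 <-> x = y.
Proof.
rewrite ilogE; have Fx := F_gt0 x; have Fy := F_gt0 y; split=> [i0|<-].
- apply/(is_metric_eq0 d_metric)/eqP; rewrite eq_le d_ge0 andbT.
  have /ln_inj eqs : ln (isum x y ^+ 2) = ln (2 ^+ 2 * (F x * F y)).
    rewrite lnM ?posrE ?mulr_gt0// [ln (F x * _)]lnM ?posrE//.
    by rewrite !lnXn ?isum_gt0//; lra.
  have {}eqs : isum x y ^+ 2 = 2 ^+ 2 * (F x * F y).
    by apply: eqs; rewrite posrE ?exprn_gt0 ?isum_gt0// !mulr_gt0.
  have le_s : isum x y ^+ 2 <= (F x + F y) ^+ 2.
    rewrite eqs -subr_ge0; have := sqr_ge0 (F x - F y).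
    by congr (_ <= _); ring.
  have s_ge0 : 0 <= isum x y by exact/ltW/isum_gt0.
  have FF_ge0 : 0 <= F x + F y by rewrite addr_ge0// ltW.
  by move: le_s; rewrite ler_pXn2r// /isum; lra.
- have dxx : d x x = 0 by apply/(is_metric_eq0 d_metric).
  have -> : isum x x = 2 * F x by rewrite /isum dxx; ring.
  by rewrite lnM ?posrE//; lra.
Qed.

Lemma ilog_is_metric : one_lipschitz d F -> is_metric ilog.
Proof.
move=> F_lip; split=> [x y|x y|x y z]; first exact: ilog_eq0.
- by rewrite !ilogE isum_sym; lra.
- have : ln (isum x z * (2 * F y)) <= ln (isum x y * isum y z).
    by rewrite ler_ln ?isum_submul ?posrE ?mulr_gt0 ?isum_gt0.
  rewrite !lnM ?posrE ?mulr_gt0 ?isum_gt0// !ilogE; lra.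
Qed.

Lemma ilog_four_point x y z w :
  ilog x z + ilog y w <=
  Num.max (ilog x w + ilog y z) (ilog x y + ilog z w) + 2 * ln 4.
Proof.
have s0 a b : 0 <= isum a b by exact/ltW/isum_gt0.
have := four_point_mul s0 isum_sym isum_triangle x y z w.
rewrite !ilogE -lerBlDr le_max maxr_pMr// le_max => /orP[] le_ss.
- have : ln (isum x z * isum y w) <= ln (4 * (isum x w * isum y z)).
    by rewrite ler_ln ?posrE ?mulr_gt0 ?isum_gt0.
  rewrite !lnM ?posrE ?mulr_gt0 ?isum_gt0// => le_ln.
  by apply/orP; left; lra.
- have : ln (isum x z * isum y w) <= ln (4 * (isum x y * isum z w)).
    by rewrite ler_ln ?posrE ?mulr_gt0 ?isum_gt0.
  rewrite !lnM ?posrE ?mulr_gt0 ?isum_gt0// => le_ln.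
  by apply/orP; right; lra.
Qed.

Lemma ilog_gromov_hyperbolic :
  one_lipschitz d F -> gromov_hyperbolic ilog (ln 4).
Proof.
move=> F_lip; split; first exact: ilog_is_metric.
- by rewrite ln_ge0// ler1n.
- exact: ilog_four_point.
Qed.

End WeightedMetric.

Theorem theorem14 (R : realType) (X : metricType R) (M : set X)
    (M_closed : closed M) (M_nonempty : M !=set0) (M_proper : M <> setT)
    (F : ~` M -> R) (F_gt0 : forall x : ~` M, 0 < F x)
    (F_lip : one_lipschitz (@subspace_dist R X (~` M)) F) :
  exists2 delta : R,
    gromov_hyperbolic (i_metric F) delta & delta <= ln 9.
Proof.
exists (ln 4); last by rewrite ler_ln ?posrE ?ltr0n// ler_nat.
exact: (ilog_gromov_hyperbolic (is_metric_subspace_dist _) F_gt0 F_lip).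
Qed.
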